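(* Let $K:\mathbb{R}^n\to\mathbb{R}^n$ be a linear operator, let $\{f_j\}_{j=1}^n$ be a $K$-frame for $\mathbb{R}^n$, let $P:\mathbb{R}^n\to\mathbb{R}^n$ be an orthogonal projection with $PK=KP$, put $X=P(\mathbb{R}^n)$ and $Y=(I-P)(\mathbb{R}^n)$, and let $\{a_j\}_{j=1}^n,\{b_j\}_{j=1}^n$ be real constants. Let $T_1$ and $T_2$ be the analysis operators of $\{Pf_j\}_{j=1}^n$ and $\{(I-P)f_j\}_{j=1}^n$, respectively. Then the following assertions are equivalent. (a) $(f_j,P,a_j,b_j)_{j=1}^n$ is a $K_s^p$-frame. (b) If $D_1$ and $D_2$ are the diagonal operators on $\ell^2(n)$ with diagonal elements $\{a_j\}_{j=1}^n$ and $\{b_j\}_{j=1}^n$, respectively, then $$T_1^*D_1^2T_1=KK^*|_X,\qquad T_2^*D_2^2T_2=KK^*|_Y\qquad\text{and}\qquad T_1^*D_1D_2T_2=0.$$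
   Context: A finite family $\{g_j\}_{j=1}^n$ in $\mathbb{R}^n$ is a $K$-frame for $\mathbb{R}^n$ if there are constants $A,B>0$ with $A\|K^*f\|^2\le\sum_j|\langle f,g_j\rangle|^2\le B\|f\|^2$ for every $f\in\mathbb{R}^n$. For a $K$-frame $\{f_j\}_{j=1}^n$ for $\mathbb{R}^n$, an orthogonal projection $P$ and constants $a_j,b_j$, one says that $(f_j,P,a_j,b_j)_{j=1}^n$ is a $K_s^p$-frame (piecewise scalable $K$-frame) if $\sum_{j=1}^n|\langle f,\,a_jPf_j+b_j(I-P)f_j\rangle|^2=\|K^*f\|^2$ for every $f\in\mathbb{R}^n$. The space $\ell^2(n)$ is $\mathbb{R}^n$ with its standard inner product. The analysis operator of a family $\{g_j\}_{j=1}^n$ is $f\mapsto\{\langle f,g_j\rangle\}_{j=1}^n$; thus $T_1f=\{\langle f,Pf_j\rangle\}_{j=1}^n$ and $T_2f=\{\langle f,(I-P)f_j\rangle\}_{j=1}^n$. The first two identities in (b) are equalities of operators on $X$ and on $Y$, respectively ($|_X$, $|_Y$ denote restriction). *)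

(* Defs.v *)
From HB Require Import structures.
From mathcomp Require Import all_boot all_order all_algebra.
From mathcomp Require Import reals.

Set Implicit Arguments.
Unset Strict Implicit.
Unset Printing Implicit Defensive.

Import Order.TTheory GRing.Theory Num.Theory.

Local Open Scope ring_scope.

Definition dot (R : realType) (n : nat) (x y : 'cV[R]_n) : R :=
  \sum_(i < n) x i 0 * y i 0.

Definition enorm (R : realType) (n : nat) (x : 'cV[R]_n) : R :=
  Num.sqrt (dot x x).

(* [linfun] turns a function into an element of 'Hom and is only meaningful on
   linear functions; [adjoint_funE], [analysisE] and [diag_opE] below show that
   it is applied to linear functions only. *)

(* The i-th coordinate of A^* y is <e_i, A^* y> = <A e_i, y>; the characteristic
   property and the uniqueness of the adjoint are [adjointP] and
   [adjoint_uniq]. *)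
Definition adjoint_fun (R : realType) (m n : nat)
    (A : 'Hom('cV[R]_m, 'cV[R]_n)) (y : 'cV[R]_n) : 'cV[R]_m :=
  \col_i dot (A (delta_mx i 0)) y.

Definition adjoint (R : realType) (m n : nat)
    (A : 'Hom('cV[R]_m, 'cV[R]_n)) : 'Hom('cV[R]_n, 'cV[R]_m) :=
  linfun (adjoint_fun A).

Definition analysis_fun (R : realType) (m n : nat) (g : 'I_m -> 'cV[R]_n)
    (x : 'cV[R]_n) : 'cV[R]_m := \col_j dot x (g j).

Definition analysis (R : realType) (m n : nat) (g : 'I_m -> 'cV[R]_n) :
    'Hom('cV[R]_n, 'cV[R]_m) := linfun (analysis_fun g).

Definition diag_fun (R : realType) (m : nat) (a : 'I_m -> R)
    (x : 'cV[R]_m) : 'cV[R]_m := \col_j (a j * x j 0).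

Definition diag_op (R : realType) (m : nat) (a : 'I_m -> R) :
    'End('cV[R]_m) := linfun (diag_fun a).

Definition orthogonal_projection (R : realType) (n : nat)
    (P : 'End('cV[R]_n)) : Prop :=
  (P \o P)%VF = P /\ adjoint P = P.

Definition K_frame (R : realType) (n : nat) (K : 'End('cV[R]_n))
    (g : 'I_n -> 'cV[R]_n) : Prop :=
  exists A B : R, [/\ 0 < A, 0 < B &
    forall x : 'cV[R]_n,
      A * enorm (adjoint K x) ^+ 2 <= \sum_(j < n) `|dot x (g j)| ^+ 2
      /\ \sum_(j < n) `|dot x (g j)| ^+ 2 <= B * enorm x ^+ 2].

Definition piecewise_scalable_K_frame (R : realType) (n : nat)
    (K : 'End('cV[R]_n)) (f : 'I_n -> 'cV[R]_n) (P : 'End('cV[R]_n))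
    (a b : 'I_n -> R) : Prop :=
  [/\ K_frame K f, orthogonal_projection P &
    forall x : 'cV[R]_n,
      \sum_(j < n)
        `|dot x (a j *: P (f j) + b j *: (\1 - P)%VF (f j))| ^+ 2
      = enorm (adjoint K x) ^+ 2].

Section Facts.
Variable R : realType.

Lemma dotC n (x y : 'cV[R]_n) : dot x y = dot y x.
Proof. by apply: eq_bigr => i _; rewrite mulrC. Qed.

Lemma dot_linear n (x : 'cV[R]_n) (c : R) (y z : 'cV[R]_n) :
  dot x (c *: y + z) = c * dot x y + dot x z.
Proof.
rewrite /dot mulr_sumr -big_split; apply: eq_bigr => i _ /=.
by rewrite !mxE mulrDr mulrCA.
Qed.

Lemma dot_delta n (i : 'I_n) (x : 'cV[R]_n) : dot (delta_mx i 0) x = x i 0.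
Proof.
rewrite /dot (bigD1 i) //= big1 => [|j ne_ji]; last first.
  by rewrite mxE (negPf ne_ji) mul0r.
by rewrite mxE !eqxx mul1r addr0.
Qed.

Lemma linfunE_of_linear (m n : nat) (h : 'cV[R]_m -> 'cV[R]_n) :
  linear h -> linfun h =1 h.
Proof.
move=> lin_h.
pose M := GRing.isLinear.Build R 'cV[R]_m 'cV[R]_n _ h lin_h.
pose H : {linear 'cV[R]_m -> 'cV[R]_n} := HB.pack h M.
exact: (lfunE H).
Qed.

Lemma adjoint_funE m n (A : 'Hom('cV[R]_m, 'cV[R]_n)) :
  adjoint A =1 adjoint_fun A.
Proof.
apply: linfunE_of_linear => c x y.
by apply/colP => i; rewrite !mxE dot_linear.
Qed.

Lemma analysisE m n (g : 'I_m -> 'cV[R]_n) : analysis g =1 analysis_fun g.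
Proof.
apply: linfunE_of_linear => c x y.
by apply/colP => i; rewrite !mxE dotC dot_linear !(dotC (g i)).
Qed.

Lemma diag_opE m (a : 'I_m -> R) : diag_op a =1 diag_fun a.
Proof.
apply: linfunE_of_linear => c x y.
by apply/colP => i; rewrite !mxE mulrDr mulrCA.
Qed.

Lemma adjointP m n (A : 'Hom('cV[R]_m, 'cV[R]_n)) x y :
  dot (A x) y = dot x (adjoint A y).
Proof.
have Ax : A x = \sum_i x i 0 *: A (delta_mx i 0).
  rewrite [in LHS](matrix_sum_delta x) linear_sum; apply: eq_bigr => i _.
  by rewrite big_ord1 linearZ.
rewrite Ax adjoint_funE /dot.
under eq_bigr => k _ do rewrite summxE mulr_suml.
rewrite exchange_big; apply: eq_bigr => i _ /=.
rewrite mxE /dot mulr_sumr; apply: eq_bigr => k _.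
by rewrite mxE mulrA.
Qed.

Lemma adjoint_uniq m n (A : 'Hom('cV[R]_m, 'cV[R]_n))
    (B : 'Hom('cV[R]_n, 'cV[R]_m)) :
  (forall x y, dot (A x) y = dot x (B y)) -> B = adjoint A.
Proof.
move=> AB; apply/lfunP => y; apply/colP => i.
by rewrite -!dot_delta -AB adjointP.
Qed.

End Facts.

(* Main.v *)
(* With [V := D1 T1 + D2 T2] the defining identity of a piecewise scalable
   K-frame reads |V x|^2 = |K^* x|^2, which polarizes to
   <V x, V y> = <K^* x, K^* y>.  Since [T1] vanishes on [Y] and [T2] on [X],
   the operators of (b) are the blocks of the form <V x, V y> with respect to
   [X] and [Y].  As P commutes with K^*, the form <K^* x, K^* y> is block
   diagonal, and comparing blocks gives both implications. *)
Require Import Defs.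
From mathcomp Require Import all_boot all_order all_algebra.
From mathcomp Require Import reals.
From mathcomp Require Import lra.

Set Implicit Arguments.
Unset Strict Implicit.
Unset Printing Implicit Defensive.

Import Order.TTheory GRing.Theory Num.Theory.

Local Open Scope ring_scope.

Section DotProduct.
Variable R : realType.

Lemma dotDr n (x y z : 'cV[R]_n) : dot x (y + z) = dot x y + dot x z.
Proof. by rewrite -[y]scale1r dot_linear mul1r scale1r. Qed.

Lemma dotDl n (x y z : 'cV[R]_n) : dot (y + z) x = dot y x + dot z x.
Proof. by rewrite !(dotC _ x) dotDr. Qed.

Lemma dot0r n (x : 'cV[R]_n) : dot x 0 = 0.
Proof. by rewrite /dot big1 // => i _; rewrite mxE mulr0. Qed.

Lemma dotZr n (x y : 'cV[R]_n) c : dot x (c *: y) = c * dot x y.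
Proof. by rewrite -[c *: y]addr0 dot_linear dot0r addr0. Qed.

Lemma dotBr n (x y z : 'cV[R]_n) : dot x (y - z) = dot x y - dot x z.
Proof. by rewrite dotDr -scaleN1r dotZr mulN1r. Qed.

Lemma dot_ext n (x y : 'cV[R]_n) : (forall z, dot z x = dot z y) -> x = y.
Proof. by move=> xy; apply/colP => i; rewrite -!dot_delta. Qed.

Lemma sqr_enorm n (x : 'cV[R]_n) : enorm x ^+ 2 = dot x x.
Proof.
by rewrite sqr_sqrtr // sumr_ge0 // => i _; rewrite -expr2 sqr_ge0.
Qed.

(** Expanding the hypothesis at [x + y] and cancelling the squares leaves, by symmetry of [dot],
    twice the desired identity. *)
Lemma dot_polarization m n p (U : 'Hom('cV[R]_m, 'cV[R]_n))
    (V : 'Hom('cV[R]_m, 'cV[R]_p)) :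
  (forall x, dot (U x) (U x) = dot (V x) (V x)) ->
  forall x y, dot (U x) (U y) = dot (V x) (V y).
Proof.
move=> UV x y; have := UV (x + y).
rewrite !linearD !dotDr !dotDl !UV (dotC (U y)) (dotC (V y)); lra.
Qed.

Lemma diag_opP m (a : 'I_m -> R) x y :
  dot (diag_op a x) y = dot x (diag_op a y).
Proof.
rewrite !diag_opE; apply: eq_bigr => i _.
by rewrite !mxE mulrCA mulrA.
Qed.

(** The adjoint of [S] and the self-adjoint [diag_op a] move to the left argument. This turns all
    three operators of (b) into bilinear forms. *)
Lemma dot_block m n (a b : 'I_m -> R) (S T : 'Hom('cV[R]_n, 'cV[R]_m)) x y :
  dot y ((adjoint S \o (diag_op a \o diag_op b) \o T)%VF x)
  = dot ((diag_op a \o S)%VF y) ((diag_op b \o T)%VF x).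
Proof. by rewrite !comp_lfunE -adjointP -diag_opP. Qed.

End DotProduct.

Section OrthogonalProjection.
Variables (R : realType) (n : nat).
Implicit Types P K : 'End('cV[R]_n).

Lemma projP P x y :
  orthogonal_projection P -> dot (P x) y = dot x (P y).
Proof. by case=> _ adjP; rewrite adjointP adjP. Qed.

Lemma projK P x : orthogonal_projection P -> P (P x) = P x.
Proof. by case=> idP _; rewrite -{3}idP comp_lfunE. Qed.

Lemma proj_limg P x :
  orthogonal_projection P -> x \in limg P -> P x = x.
Proof. by move=> hP /memv_imgP [y _ ->]; rewrite projK. Qed.

Lemma complE P x : (\1 - P)%VF x = x - P x.
Proof. by rewrite add_lfunE opp_lfunE id_lfunE. Qed.

Lemma orthogonal_projection_compl P :
  orthogonal_projection P -> orthogonal_projection (\1 - P)%VF.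
Proof.
move=> hP; split.
  apply/lfunP => x.
  by rewrite comp_lfunE !complE linearB /= projK // subrr subr0.
apply/esym/adjoint_uniq => x y.
rewrite !complE dotBr (dotC _ y) dotBr.
by rewrite (dotC y x) (dotC y) projP.
Qed.

(** Take adjoints in the commutation relation; [P] is its own adjoint. *)
Lemma adjoint_proj_comm P K x :
  orthogonal_projection P -> (P \o K)%VF = (K \o P)%VF ->
  adjoint K (P x) = P (adjoint K x).
Proof.
move=> hP hPK; apply: dot_ext => z.
rewrite -adjointP -!(projP _ _ hP) -adjointP.
by rewrite -comp_lfunE hPK comp_lfunE.
Qed.

(** Self-adjointness moves [P] from the family to the argument, so the analysis operator of the
    projected family vanishes on the kernel of [P]. *)
Lemma analysis_proj P m (f : 'I_m -> 'cV[R]_n) x :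
  orthogonal_projection P ->
  analysis (fun j => P (f j)) x = analysis f (P x).
Proof.
by move=> hP; rewrite !analysisE; apply/colP => j; rewrite !mxE projP.
Qed.

End OrthogonalProjection.

Theorem proposition4p6 (R : realType) (n : nat) (K : 'End('cV[R]_n))
    (f : 'I_n -> 'cV[R]_n) (P : 'End('cV[R]_n)) (a b : 'I_n -> R)
    (hf : K_frame K f) (hP : orthogonal_projection P)
    (hPK : (P \o K)%VF = (K \o P)%VF) :
  let X : {vspace 'cV[R]_n} := limg P in
  let Y : {vspace 'cV[R]_n} := limg (\1 - P)%VF in
  let T1 := analysis (fun j => P (f j)) in
  let T2 := analysis (fun j => (\1 - P)%VF (f j)) in
  let D1 := diag_op a in
  let D2 := diag_op b in
  piecewise_scalable_K_frame K f P a b <->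
  [/\ {in X, (adjoint T1 \o (D1 \o D1) \o T1)%VF =1 (K \o adjoint K)%VF},
      {in Y, (adjoint T2 \o (D2 \o D2) \o T2)%VF =1 (K \o adjoint K)%VF}
    & (adjoint T1 \o (D1 \o D2) \o T2)%VF = 0].
Proof.
move=> X Y T1 T2 D1 D2.
(* [P] and its complement can now be treated by the same lemmas. *)
have hQ := orthogonal_projection_compl hP.
set Q := (\1 - P)%VF in Y T2 hQ *.
have PQ x : x = P x + Q x by rewrite complE addrC subrK.
have PQ0 x : P (Q x) = 0 by rewrite complE linearB /= projK // subrr.
have QP0 x : Q (P x) = 0 by rewrite complE projK // subrr.
have KP x : adjoint K (P x) = P (adjoint K x) by apply: adjoint_proj_comm.
have KQ x : adjoint K (Q x) = Q (adjoint K x).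
  by rewrite !complE linearB /= KP.
pose U1 := (D1 \o T1)%VF; pose U2 := (D2 \o T2)%VF.
have U1P x : U1 (P x) = U1 x.
  by rewrite !comp_lfunE !analysis_proj // projK.
have U2Q x : U2 (Q x) = U2 x.
  by rewrite !comp_lfunE !analysis_proj // projK.
have U1Q x : U1 (Q x) = 0 by rewrite -U1P PQ0 linear0.
have U2P x : U2 (P x) = 0 by rewrite -U2Q QP0 linear0.
pose V := (U1 + U2)%VF.
have VP x : V (P x) = U1 x by rewrite add_lfunE U1P U2P addr0.
have VQ x : V (Q x) = U2 x by rewrite add_lfunE U2Q U1Q add0r.
(* The inner product in the [j]-th term is the [j]-th coordinate of [V x]. *)
have sumV x : \sum_(j < n) `|dot x (a j *: P (f j) + b j *: Q (f j))| ^+ 2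
            = dot (V x) (V x).
  apply: eq_bigr => j _; rewrite real_normK ?num_real // expr2.
  rewrite dotDr !dotZr [V x]add_lfunE !comp_lfunE.
  by rewrite !diag_opE !analysisE !mxE.
have KK x y : dot y ((K \o adjoint K)%VF x) = dot (adjoint K y) (adjoint K x).
  by rewrite comp_lfunE dotC adjointP dotC.
split=> [[_ _ scal] | [blockX blockY block0]].
  have VK x y : dot (V x) (V y) = dot (adjoint K x) (adjoint K y).
    by apply: dot_polarization => z; rewrite -sumV scal sqr_enorm.
  split=> [x /(proj_limg hP) Px | x /(proj_limg hQ) Qx | ].
  - apply: dot_ext => z.
    (* The projection on the [z] side is shifted onto the [x] side, where it is absorbed because [P]
       fixes [x]. *)
    by rewrite dot_block KK -/U1 -!VP VK !KP (projP _ _ hP) -!KP !Px.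
  - apply: dot_ext => z.
    by rewrite dot_block KK -/U2 -!VQ VK !KQ (projP _ _ hQ) -!KQ !Qx.
  - apply/lfunP => x; apply: dot_ext => z.
    (* The off-diagonal block pairs a vector in the range of [P] with one in the range of [Q], which
       are orthogonal. *)
    rewrite dot_block -/U1 -/U2 -VP -VQ VK KP KQ (projP _ _ hP) PQ0.
    by rewrite zero_lfunE !dot0r.
split=> // x; rewrite sumV sqr_enorm.
(* Only the right-hand [x] is replaced by [P x]: this puts it in [X], where [blockX] applies, and
   keeps the left factor [adjoint K x] common to [E1] and [E2]. *)
have E1 : dot (U1 x) (U1 x) = dot (adjoint K x) (adjoint K (P x)).
  by rewrite -[in X in dot _ X]U1P -dot_block blockX ?memv_img ?memvf // KK.
have E2 : dot (U2 x) (U2 x) = dot (adjoint K x) (adjoint K (Q x)).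
  by rewrite -[in X in dot _ X]U2Q -dot_block blockY ?memv_img ?memvf // KK.
have E0 : dot (U1 x) (U2 x) = 0.
  by rewrite -dot_block block0 zero_lfunE dot0r.
rewrite add_lfunE !dotDr !dotDl E1 E2 (dotC (U2 x)) E0 addr0 add0r.
(* The two diagonal blocks recombine through [P x + Q x = x]. *)
by rewrite -dotDr -linearD -PQ.
Qed.
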